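(* Let $(P,\mathcal S)$ be a polygonal tree system associated with a convex polygon $P\subset\mathbb R^2$. Then the attractor $K$ of $\mathcal S$ is a continuum with bounded turning; that is, $K$ is a continuum and there is a constant $c\ge1$ such that $K$ is of $c$-bounded turning.
   Context: A polygon is understood as a compact region of the plane with nonempty interior. Let $P\subset\mathbb R^2$ be a convex polygon with vertices $A_1,\dots,A_n$, and let $\mathcal S=\{S_1,\dots,S_m\}$ be a finite system of contracting similarities of $\mathbb R^2$ (maps with $|S_i(x)-S_i(y)|=r_i|x-y|$ for all $x,y$, where $0<r_i<1$). Put $P_k=S_k(P)$. The system $(P,\mathcal S)$ is called a polygonal tree system associated with $P$ if: (D1) $P_k\subset P$ for all $k$; (D2) for $i\ne j$, $P_i\cap P_j$ is either empty or consists of exactly one point which is a common vertex of $P_i$ and $P_j$; (D3) for every vertex $A_k$ of $P$ there is an $i$ with $A_k\in P_i$; (D4) the set $\widetilde P=\bigcup_{i=1}^m P_i$ is contractible. The attractor of $\mathcal S$ is the unique nonempty compact set $K\subset\mathbb R^2$ with $K=\bigcup_{i=1}^m S_i(K)$. For $c\ge1$, a set $A\subset\mathbb R^d$ is of $c$-bounded turning if each pair of points $a,b\in A$ can be joined by (i.e. both belong to) a continuum $F\subset A$ with $\operatorname{diam}(F)\le c\,|a-b|$. A continuum is a compact connected metric space. *)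

(* Defs.v *)
From mathcomp Require Import all_boot all_order all_algebra.
From mathcomp Require Import all_classical all_reals all_analysis.
Import Order.TTheory GRing.Theory Num.Theory.
Import numFieldNormedType.Exports.

Set Implicit Arguments.
Unset Strict Implicit.
Unset Printing Implicit Defensive.

Local Open Scope classical_set_scope.
Local Open Scope ring_scope.

(* The library norm on 'rV[R]_d is the max norm. It induces the Euclidean     *)
(* topology, so compactness, connectedness, continuity and interiors below    *)
(* are the library notions, but every metric notion uses [l2dist].           *)
Definition l2dist (R : realType) (d : nat) (x y : 'rV[R]_d) : R :=
  Num.sqrt (\sum_(i < d) (x ord0 i - y ord0 i) ^+ 2).

Definition l2diam (R : realType) (d : nat) (A : set 'rV[R]_d) : \bar R :=
  ereal_sup [set (l2dist p.1 p.2)%:E | p in A `*` A].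

Definition continuum (T : topologicalType) (A : set T) : Prop :=
  compact A /\ connected A.

Definition bounded_turning (R : realType) (d : nat) (c : R)
    (A : set 'rV[R]_d) : Prop :=
  forall a b, A a -> A b ->
    exists F : set 'rV[R]_d,
      [/\ F `<=` A, continuum F, F a, F b
        & (l2diam F <= (c * l2dist a b)%:E)%E].

(* Contractibility of A as a space, i.e. for the subspace topology. *)
Definition contractible (R : realType) (T : topologicalType)
    (A : set T) : Prop :=
  exists x0, A x0 /\
    exists H : T * R -> T,
      [/\ {within A `*` `[0, 1], continuous H},
          forall x t, A x -> t \in `[0, 1] -> A (H (x, t)),
          forall x, A x -> H (x, 0) = x
        & forall x, A x -> H (x, 1) = x0].

Definition conv_hull (R : realType) (V : lmodType R) (X : set V) : set V :=
  smallest (@convex_set R V) X.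

(* P is a convex polygon whose vertices are exactly the (necessarily          *)
(* distinct) points A 0, ..., A (n-1), listed in any order.                   *)
Definition convex_polygon (R : realType) (n : nat) (A : 'I_n -> 'rV[R]_2)
    (P : set 'rV[R]_2) : Prop :=
  [/\ P = conv_hull (range A),
      forall i, ~ conv_hull (A @` [set j | j != i]) (A i)
    & P° !=set0].

Definition contracting_similarity (R : realType) (d : nat)
    (f : 'rV[R]_d -> 'rV[R]_d) : Prop :=
  exists2 r : R, 0 < r < 1 & forall x y, l2dist (f x) (f y) = r * l2dist x y.

(* The vertices of the polygon S k @` P are the points S k (A l). *)
Record polygonal_tree_system (R : realType) (n m : nat)
    (A : 'I_n -> 'rV[R]_2) (P : set 'rV[R]_2)
    (S : 'I_m -> 'rV[R]_2 -> 'rV[R]_2) : Prop := PolygonalTreeSystem {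
  pts_similarity : forall k, contracting_similarity (S k);
  pts_sub : forall k, S k @` P `<=` P;
  pts_inter : forall i j, i != j ->
    (S i @` P) `&` (S j @` P) = set0 \/
    exists x, [/\ (S i @` P) `&` (S j @` P) = [set x],
                  range (S i \o A) x & range (S j \o A) x];
  pts_vertex : forall l, exists i, (S i @` P) (A l);
  pts_contractible : contractible R (\bigcup_i (S i @` P))
}.

Definition attractor (R : realType) (d m : nat)
    (S : 'I_m -> 'rV[R]_d -> 'rV[R]_d) (K : set 'rV[R]_d) : Prop :=
  [/\ K !=set0, compact K & K = \bigcup_i (S i @` K)].

(* Main.v *)
Require Import Defs.
From mathcomp Require Import all_boot all_order all_algebra.
From mathcomp Require Import all_classical all_reals all_analysis.
From mathcomp Require Import ring.
Import Order.TTheory GRing.Theory Num.Theory.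
Import numFieldNormedType.Exports.

(** Write P_k and K_k for the images of the polygon P and of the attractor K
    under S_k. By self-similarity everything reduces to the first subdivision.

    The hull of a vertex and a convex set is a pyramid over that set
    ([conv_hull_pyramid]); similarities are affine ([similarity_affine]). Hence
    a vertex of P lying in P_k is the image of a vertex of P
    ([vertex_preimage]), so that all vertices belong to K, and two pieces K_i
    and K_j meet as soon as P_i and P_j do.

    Connectedness. The union of the P_k is contractible, hence connected, so
    the intersection graph of the P_k is connected. A clopen part of K is a
    union of cylinders of some level N, and by induction on N such a union is
    empty or all of K ([attractor_connected]).

    Bounded turning. Being joined by a continuum of controlled relative
    diameter is invariant under the similarities. Two points x, y lying in a
    common piece S_k(K) may therefore be replaced by their preimages under
    S_k, which are farther apart by at least a fixed factor; this stops because
    K is bounded ([joined_descent]). There remain points in distinct pieces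
    K_i, K_j. If P_i and P_j are disjoint, the distance from x to y is bounded
    below and K itself joins them. Otherwise P_i and P_j share exactly one
    vertex v, where they are pyramids meeting only at their apex, so that the
    distances from v to x and to y are bounded by a multiple of the distance
    from x to y ([pyramid_angle]); it is then enough to join v to x and v to y.
    Finally, a vertex is joined to any point of K by the same descent: once
    the vertex is not in the piece containing the point, their distance is
    bounded below ([vertex_joined]). Only finitely many configurations occur
    at the first subdivision, so the constants are uniform.

    Metric estimates are needed only up to constants, so the Euclidean distance
    is compared with the maximum norm throughout; only the fact that
    similarities are affine is truly Euclidean ([stewart]). *)

Set Implicit Arguments.
Unset Strict Implicit.
Unset Printing Implicit Defensive.

Local Open Scope classical_set_scope.
Local Open Scope ring_scope.

(** * Euclidean distance *)

Section euclidean_distance.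
Context {R : realType} {d : nat}.
Implicit Types x y z : 'rV[R]_d.

Lemma sqr_l2dist x y : l2dist x y ^+ 2 = \sum_(i < d) (x ord0 i - y ord0 i) ^+ 2.
Proof. by rewrite sqr_sqrtr// sumr_ge0// => i _; rewrite sqr_ge0. Qed.

Lemma l2dist_ge0 x y : 0 <= l2dist x y.
Proof. exact: sqrtr_ge0. Qed.

Lemma l2distC x y : l2dist x y = l2dist y x.
Proof. by congr Num.sqrt; apply: eq_bigr => i _; rewrite -sqrrN opprB. Qed.

Lemma norm_le_l2dist x y : `|x - y| <= l2dist x y.
Proof.
rewrite /Num.norm/= mx_normrE; apply/bigmax_leP; split=> [|[i j] _ /=].
  exact: l2dist_ge0.
rewrite (ord1 i) !mxE -[leRHS]ger0_norm ?l2dist_ge0// -ler_sqr ?nnegrE//.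
rewrite !real_normK ?num_real// sqr_l2dist (bigD1 j)//= lerDl.
by rewrite sumr_ge0// => k _; rewrite sqr_ge0.
Qed.

Lemma l2dist_le_norm x y : l2dist x y <= d%:R * `|x - y|.
Proof.
rewrite -ler_sqr ?nnegrE ?l2dist_ge0 ?mulr_ge0 ?ler0n// sqr_l2dist exprMn.
have : \sum_(i < d) (x ord0 i - y ord0 i) ^+ 2 <= d%:R * `|x - y| ^+ 2.
  apply: (@le_trans _ _ (\sum_(i < d) `|x - y| ^+ 2)); last first.
    by rewrite sumr_const card_ord mulr_natl.
  apply: ler_sum => i _.
  rewrite -real_normK ?num_real// ler_sqr ?nnegrE//.
  rewrite [leRHS]/Num.norm/= mx_normrE; apply/bigmax_geP; right.
  by exists (ord0, i) => //=; rewrite !mxE.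
move/le_trans; apply; rewrite ler_wpM2r ?sqr_ge0// -natrX ler_nat.
by case: (d) => // k; rewrite expnS expn1 leq_pmull.
Qed.

Lemma l2dist0_eq x y : l2dist x y = 0 -> x = y.
Proof.
move=> xy; apply/eqP; rewrite -subr_eq0 -normr_le0.
by rewrite -xy norm_le_l2dist.
Qed.

Lemma l2distxx x : l2dist x x = 0.
Proof.
apply/eqP; rewrite eq_le l2dist_ge0 andbT.
by rewrite (le_trans (l2dist_le_norm x x))// subrr normr0 mulr0.
Qed.

(** The maximum norm gives the triangle inequality up to the factor d, which is
    all that a statement up to constants requires. *)
Lemma l2dist_quasi_triangle x y z :
  l2dist x z <= d%:R * (l2dist x y + l2dist y z).
Proof.
rewrite (le_trans (l2dist_le_norm x z))// ler_wpM2l ?ler0n//.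
by rewrite (le_trans (ler_distD y x z))// lerD// norm_le_l2dist.
Qed.

(** Stewart's theorem: the distances from w to x, to y and between x and y
    determine the distance from w to a point of the line xy. This is what makes
    a similarity affine. *)
Lemma stewart (t : R) w x y :
  l2dist w (x + t *: (y - x)) ^+ 2 =
  (1 - t) * l2dist w x ^+ 2 + t * l2dist w y ^+ 2 - t * (1 - t) * l2dist x y ^+ 2.
Proof.
rewrite !sqr_l2dist !mulr_sumr -big_split -sumrB/=; apply: eq_bigr => i _.
by rewrite !mxE; ring.
Qed.

Lemma compact_l2dist_bounded (X : set 'rV[R]_d) : compact X ->
  exists M, forall x y, X x -> X y -> l2dist x y <= M.
Proof.
move=> /compact_bounded/pinfty_ex_gt0 [M _ XM]; exists (d%:R * (M + M)).
move=> x y Xx Xy; rewrite (le_trans (l2dist_le_norm x y))//.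
by rewrite ler_wpM2l ?ler0n// (le_trans (ler_normB x y))// lerD// XM.
Qed.

End euclidean_distance.

(** * Convex hulls of finite sets *)

Section convex.
Context {R : realType} {d : nat}.
Implicit Types (H C X : set 'rV[R]_d) (x : 'rV[R]_d).

(** Segments are parametrized by x + t (y - x) because this is the form in which
    similarities are affine. *)
Lemma convex_setP C : @convex_set R 'rV[R]_d C <->
  forall x y t, 0 <= t <= 1 -> C x -> C y -> C (x + t *: (y - x)).
Proof.
split=> [cC x y t /andP[t0 t1] Cx Cy|cC x y t /set_mem Cx /set_mem Cy].
  have := cC y x (Itv01 t0 t1); rewrite !in_setE => /(_ Cy Cx).
  by congr C; apply/rowP => i; rewrite !mxE/= /unstable.onem; ring.
apply/mem_set.
have := cC y x t%:num; rewrite ge0 le1 => /(_ isT Cy Cx).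
by congr C; apply/rowP => i; rewrite !mxE/= /unstable.onem; ring.
Qed.

Lemma conv_hull_segment X x y t : 0 <= t <= 1 ->
  conv_hull X x -> conv_hull X y -> conv_hull X (x + t *: (y - x)).
Proof.
move=> t01 Xx Xy C CX; have [/convex_setP cC _] := CX.
by apply: cC => //; [exact: Xx|exact: Xy].
Qed.

Lemma conv_hull_min X C :
  (forall x y t, 0 <= t <= 1 -> C x -> C y -> C (x + t *: (y - x))) ->
  X `<=` C -> conv_hull X `<=` C.
Proof. by move=> /convex_setP; exact: smallest_sub. Qed.

Lemma sub_conv_hull X : X `<=` conv_hull X.
Proof. exact: sub_gen_smallest. Qed.

(** The apex is added separately, so that a pyramid over the empty set is still
    the hull of its apex. *)
Definition pyramid (x : 'rV[R]_d) (H : set 'rV[R]_d) : set 'rV[R]_d :=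
  [set z | z = x \/ exists t u, [/\ 0 <= t <= 1, H u & z = x + t *: (u - x)]].

(** The pyramid is convex: on a segment joining two of its points the weights of
    the base points are combined into one base point. *)
Lemma conv_hull_pyramid x X :
  conv_hull (x |` X) = pyramid x (conv_hull X).
Proof.
apply/seteqP; split.
  apply: conv_hull_min => [a b t /andP[t0 t1]|z [->|Xz]]; last 2 first.
  - by left.
  - right; exists 1, z; split; rewrite ?ler01 ?lexx//; first exact: sub_conv_hull.
    by rewrite scale1r addrC subrK.
  - have [Hx|] := pselect (exists u, conv_hull X u); last first.
      move=> H0 [->|[s [u [_ Xu]]]]; last by case: H0; exists u.
      move=> [->|[s [u [_ Xu]]]]; last by case: H0; exists u.
      by left; rewrite subrr scaler0 addr0.
    (* Over a nonempty base the apex is the case t = 0. *)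
    have pyramidE : pyramid x (conv_hull X) =
        [set z | exists t u,
          [/\ 0 <= t <= 1, conv_hull X u & z = x + t *: (u - x)]].
      apply/seteqP; split=> z; last by right.
      case=> // ->; case: Hx => u Xu; exists 0, u; split; rewrite ?lexx ?ler01//.
      by rewrite scale0r addr0.
    rewrite pyramidE => -[s [u [/andP[s0 s1] Xu ->]]].
    move=> [s' [u' [/andP[s'0 s'1] Xu' ->]]].
    (* The total weight of u and u' in the point a + t (b - a). *)
    pose c := (1 - t) * s + t * s'.
    have t'0 : 0 <= 1 - t by rewrite subr_ge0.
    have ts0 : 0 <= (1 - t) * s by rewrite mulr_ge0.
    have ts'0 : 0 <= t * s' by rewrite mulr_ge0.
    have c1 : c <= 1.
      apply: (@le_trans _ _ ((1 - t) * 1 + t * 1)); last by rewrite !mulr1 subrK.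
      by rewrite lerD// ler_wpM2l.
    have c0 : 0 <= c by rewrite addr_ge0.
    have [cE|cN0] := eqVneq c 0.
      exists 0, u; split; rewrite ?lexx ?ler01//.
      move/eqP: cE; rewrite paddr_eq0// => /andP[/eqP E1 /eqP E2].
      apply/rowP => i; rewrite !mxE.
      transitivity (x ord0 i + (1 - t) * s * (u ord0 i - x ord0 i)
        + t * s' * (u' ord0 i - x ord0 i)); first by ring.
      by rewrite E1 E2; ring.
    exists c, (u + (t * s' / c) *: (u' - u)); split; first by rewrite c0.
      apply: conv_hull_segment => //; rewrite divr_ge0//= ler_pdivrMr ?mul1r ?lerDr//.
      by rewrite lt_neqAle eq_sym cN0.
    by apply/rowP => i; rewrite !mxE; move: cN0; rewrite /c => cN0; field.
move=> z [->|[t [u [t01 Xu ->]]]]; first by apply: sub_conv_hull; left.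
apply: conv_hull_segment => //; first by apply: sub_conv_hull; left.
by move: Xu; apply: conv_hull_min => [*|w Xw];
  [exact: conv_hull_segment|apply: sub_conv_hull; right].
Qed.

Lemma pyramid_compact x H : compact H -> compact (pyramid x H).
Proof.
move=> cH.
have -> : pyramid x H =
    [set x] `|` (fun p : R * 'rV[R]_d => x + p.1 *: (p.2 - x)) @` (`[0, 1] `*` H).
  apply/seteqP; split=> z; case=> [->|]; [by left| |by left|].
    move=> [t [u [t01 Hu ->]]].
    by right; exists (t, u) => //; split=> //=; rewrite in_itv.
  move=> [[t u] [/= t01 Hu] <-]; right; exists t, u.
  by split=> //; rewrite in_itv in t01.
apply: compactU; first exact: compact_set1.
apply: continuous_compact; last first.
  by apply: compact_setX => //; exact: segment_compact.
apply: continuous_subspaceT => p.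
apply: cvgD; first exact: cvg_cst.
apply: cvgZ; first exact: cvg_fst.
by apply: cvgB; [exact: cvg_snd|exact: cvg_cst].
Qed.

Lemma conv_hull0 : conv_hull (@set0 'rV[R]_d) = set0.
Proof. by apply/seteqP; split=> //; apply: conv_hull_min. Qed.

(** Adding the points one by one, each hull is a pyramid over the previous one. *)
Lemma finite_conv_hull_compact X : finite_set X -> compact (conv_hull X).
Proof.
move=> /finite_seqP[s ->]; elim: s => [|x s IH].
  by rewrite set_nil conv_hull0; exact: compact0.
have -> : [set` x :: s] = x |` [set` s].
  apply/seteqP; split=> y /=; rewrite inE; first by case/orP => [/eqP|]; [left|right].
  by case=> [->|->]; rewrite ?eqxx ?orbT.
by rewrite conv_hull_pyramid; exact: pyramid_compact.
Qed.

(** A vertex outside the hull of the other points is extreme. If it were interior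
    to a segment ab, writing a and b as points of the pyramid would express
    the apex as a convex combination of base points. This form, convexity of
    the punctured hull, can be pulled back along an affine map. *)
Lemma conv_hull_vertex_extreme x X : ~ conv_hull X x ->
  forall a b t, 0 <= t <= 1 -> (conv_hull (x |` X) `\ x) a ->
   (conv_hull (x |` X) `\ x) b -> (conv_hull (x |` X) `\ x) (a + t *: (b - a)).
Proof.
move=> Xx a b t /andP[t0 t1] [Pa ax] [Pb bx]; split.
  by apply: conv_hull_segment; rewrite ?t0.
rewrite /= in ax bx * => abx; apply: Xx.
move: Pa Pb ax bx abx; rewrite conv_hull_pyramid.
case=> [//|[s [u [/andP[s0 s1] Xu ->]]]] [//|[s' [u' [/andP[s'0 s'1] Xu' ->]]]].
move=> ax bx abx.
have {}s0 : 0 < s.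
  by rewrite lt_neqAle s0 andbT; apply/eqP => E; apply: ax; rewrite -E scale0r addr0.
have {}s'0 : 0 < s'.
  by rewrite lt_neqAle s'0 andbT; apply/eqP => E; apply: bx; rewrite -E scale0r addr0.
have c0 : 0 < (1 - t) * s + t * s'.
  have [->|tN0] := eqVneq t 0; first by rewrite subr0 mul1r mul0r addr0.
  rewrite ltr_wpDl//; first by rewrite mulr_ge0 ?subr_ge0// ltW.
  by rewrite mulr_gt0// lt_neqAle eq_sym tN0.
suff -> : x = u + (t * s' / ((1 - t) * s + t * s')) *: (u' - u).
  apply: conv_hull_segment => //.
  rewrite ler_pdivrMr// mul1r lerDr divr_ge0 ?(ltW c0)//= ?mulr_ge0 ?subr_ge0//.
    exact: ltW.
  exact: ltW.
apply/rowP => i; move/rowP: abx => /(_ i); rewrite !mxE => abx.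
have cN0 := lt0r_neq0 c0.
apply: (mulfI cN0); apply/eqP; rewrite -subr_eq0; apply/eqP.
transitivity (- (x ord0 i + s * (u ord0 i - x ord0 i) +
    t * (x ord0 i + s' * (u' ord0 i - x ord0 i) -
         (x ord0 i + s * (u ord0 i - x ord0 i))) - x ord0 i)); first by field.
by rewrite abx subrr oppr0.
Qed.

End convex.

(** * Separation of compact sets and of pyramids with a common apex *)

Section separation.
Context {R : realType}.

Lemma finite_uniform_bound (I : finType) (Q : I -> R -> Prop) :
  (forall i c c', c <= c' -> Q i c -> Q i c') -> (forall i, exists c, Q i c) ->
  exists2 c, 1 <= c & forall i, Q i c.
Proof.
move=> Qmono /choice[c Qc]; exists (1 + \sum_i `|c i|) => [|i].
  by rewrite lerDl sumr_ge0.
apply: Qmono (Qc i); rewrite (le_trans (ler_norm _))// (bigD1 i)//= addrCA lerDl.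
by rewrite addr_ge0// sumr_ge0.
Qed.

Lemma compact_separated {d : nat} (X Y : set 'rV[R]_d) :
  compact X -> compact Y -> X `&` Y = set0 ->
  exists2 e, 0 < e & forall x y, X x -> Y y -> e <= `|x - y|.
Proof.
move=> cX cY XY0.
have cXY : compact ((fun p : 'rV[R]_d * 'rV[R]_d => p.1 - p.2) @` (X `*` Y)).
  apply: continuous_compact; last exact: compact_setX.
  by apply: continuous_subspaceT => p; apply: cvgB; [exact: cvg_fst|exact: cvg_snd].
have /closed_openC := compact_closed (@norm_hausdorff _ _) cXY.
rewrite openE => /(_ 0) XY_0; have {XY_0}/nbhs_ballP[] : nbhs (0 : 'rV[R]_d)
    (~` ((fun p : 'rV[R]_d * 'rV[R]_d => p.1 - p.2) @` (X `*` Y))).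
  apply: XY_0 => -[[x y] [/= Xx Yy]] /subr0_eq xy.
  by rewrite -[False]/(set0 x) -XY0; split=> //; rewrite xy.
move=> e /= e0 eXY; exists e => // x y Xx Yy; rewrite leNgt; apply/negP => xye.
apply: (eXY (x - y)); last by exists (x, y).
by rewrite -ball_normE/= sub0r normrN.
Qed.

(** For t = 1 this is the separation of the base of the first pyramid from the
    whole second one; the general case follows by scaling from the apex, and
    needs t' <= t to keep the scaled second point in its pyramid. *)
Lemma pyramid_angle_half {d : nat} (x : 'rV[R]_d) H1 H2 : compact H1 -> compact H2 ->
  ~ H1 x -> pyramid x H1 `&` pyramid x H2 `<=` [set x] ->
  exists e, 0 < e /\ forall t u t' u', H1 u -> H2 u' -> 0 <= t' <= t -> t <= 1 ->
    t * e <= `|(x + t *: (u - x)) - (x + t' *: (u' - x))|.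
Proof.
move=> cH1 cH2 H1x H12.
have /(compact_separated cH1 (pyramid_compact (x := x) cH2))[e e0 eH] :
    H1 `&` pyramid x H2 = set0.
  apply/seteqP; split=> // z [H1z Pz]; have : z = x.
    apply: H12; split => //; right; exists 1, z; split; rewrite ?ler01 ?lexx//.
    by rewrite scale1r addrC subrK.
  by move=> zx; apply: H1x; rewrite -zx.
exists e; split=> // t u t' u' H1u H2u' /andP[t'0 t't] t1.
have [t0|tN0] := eqVneq t 0; first by rewrite t0 mul0r.
have t_gt0 : 0 < t by rewrite lt_neqAle eq_sym tN0 (le_trans t'0 t't).
have -> : x + t *: (u - x) - (x + t' *: (u' - x)) =
    t *: (u - (x + (t' / t) *: (u' - x))).
  by apply/rowP => i; rewrite !mxE; field.
rewrite normrZ gtr0_norm// ler_pM2l//; apply: eH => //; right.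
exists (t' / t), u'; split=> //.
by rewrite divr_ge0 ?(ltW t_gt0)//= ler_pdivrMr// mul1r.
Qed.

(** Two pyramids meeting only at their apex x make a positive angle there: the
    distance between points of parameters t and t' is at least a multiple of
    the larger of t and t', whereas the distance from a to x is at most a
    multiple of t. *)
Lemma pyramid_angle {d : nat} (x : 'rV[R]_d) H1 H2 : compact H1 -> compact H2 ->
  ~ H1 x -> ~ H2 x -> pyramid x H1 `&` pyramid x H2 `<=` [set x] ->
  exists c, forall a b, pyramid x H1 a -> pyramid x H2 b ->
    `|a - x| <= c * `|a - b|.
Proof.
move=> cH1 cH2 H1x H2x H12.
have [e1 [e10 eH1]] := pyramid_angle_half cH1 cH2 H1x H12.
have [|e2 [e20 eH2]] := pyramid_angle_half cH2 cH1 H2x _; first by rewrite setIC.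
have /pinfty_ex_gt0[M M0 HM] := compact_bounded cH1.
pose e := Num.min e1 e2; have e0 : 0 < e by rewrite lt_min e10.
exists (1 + (M + `|x|) / e) => a b.
have M'0 : 0 <= M + `|x| by rewrite addr_ge0// ltW.
have c1 : 1 <= 1 + (M + `|x|) / e by rewrite lerDl divr_ge0// ltW.
case=> [->|[t [u [/andP[t0 t1] Hu ->]]]].
  by rewrite subrr normr0 mulr_ge0// (le_trans ler01).
case=> [->|[t' [u' [/andP[t'0 t'1] Hu' ->]]]]; first by rewrite ler_peMl.
suff tE : Num.max t t' * e <= `|x + t *: (u - x) - (x + t' *: (u' - x))|.
  rewrite addrAC subrr add0r normrZ ger0_norm// mulrDl mul1r.
  apply: (@le_trans _ _ (Num.max t t' * (M + `|x|))).
    apply: ler_pM => //; first by rewrite le_max lexx.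
    by rewrite (le_trans (ler_normB _ _))// lerD2r HM.
  apply: (@le_trans _ _ ((M + `|x|) / e * (Num.max t t' * e))).
    by rewrite mulrCA divfK ?gt_eqF.
  by rewrite -[leLHS]add0r lerD// ler_wpM2l// divr_ge0// ltW.
have [tt'|/ltW tt'] := leP t t'.
  rewrite distrC (le_trans _ (eH2 _ _ _ _ Hu' Hu _ t'1)) ?t0//.
  by rewrite ler_wpM2l// ge_min lexx orbT.
rewrite (le_trans _ (eH1 _ _ _ _ Hu Hu' _ t1)) ?t'0//.
by rewrite ler_wpM2l// ge_min lexx.
Qed.

End separation.

(** * Similarities *)

Section similarity.
Context {R : realType} {d : nat}.
Implicit Types (f : 'rV[R]_d -> 'rV[R]_d).

Lemma similarity_affine f (t : R) x y : contracting_similarity f ->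
  f (x + t *: (y - x)) = f x + t *: (f y - f x).
Proof.
move=> [r _ fE]; apply: l2dist0_eq; apply/eqP; rewrite -sqrf_eq0 stewart !fE !exprMn.
rewrite (l2distC _ x) (l2distC _ y) !stewart !l2distxx (l2distC y x).
by apply/eqP; ring.
Qed.

Lemma similarity_inj f : contracting_similarity f -> injective f.
Proof.
move=> [r /andP[r0 _] fE] x y fxy; apply: l2dist0_eq.
by apply: (mulfI (lt0r_neq0 r0)); rewrite -fE fxy l2distxx mulr0.
Qed.

Lemma similarity_continuous f : contracting_similarity f -> continuous f.
Proof.
move=> [r /andP[r0 r1] fE] x V /nbhs_ballP[e /= e0 eV].
have d0 : 0 < d%:R + 1 :> R by rewrite ltr_wpDl.
apply/nbhs_ballP; exists (e / (d%:R + 1)) => [|y]; first by rewrite /= divr_gt0.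
rewrite -ball_normE /= ltr_pdivlMr// => xy; apply: eV; rewrite -ball_normE /=.
rewrite (le_lt_trans (norm_le_l2dist _ _))// fE.
apply: (@le_lt_trans _ _ (l2dist x y)).
  by rewrite ler_piMl ?l2dist_ge0// ltW.
apply: le_lt_trans xy; rewrite mulrC (le_trans (l2dist_le_norm x y))//.
by rewrite ler_wpM2r// lerDl.
Qed.

Lemma similarity_pyramid f x H : contracting_similarity f ->
  f @` pyramid x H = pyramid (f x) (f @` H).
Proof.
move=> sf; apply/seteqP; split=> z.
  move=> [_ [->|[t [u [t01 Hu ->]]]] <-]; first by left.
  by right; exists t, (f u); split=> //; rewrite similarity_affine.
case=> [->|[t [_ [t01 [u Hu <-] ->]]]]; first by exists x => //; left.
exists (x + t *: (u - x)); last by rewrite similarity_affine.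
by right; exists t, u.
Qed.

End similarity.

Lemma geometric_small {R : realType} (M r e : R) : 0 <= r < 1 -> 0 < e ->
  exists N, M * r ^+ N < e.
Proof.
move=> /andP[r0 r1] e0.
have : M * r ^+ n @[n --> \oo] --> M * 0.
  by apply: cvgM; [exact: cvg_cst|apply: cvg_expr; rewrite ger0_norm].
rewrite mulr0 => /cvgrPdist_lt/(_ _ e0)[N _ /(_ N (leqnn N))].
by rewrite /= sub0r normrN => /(le_lt_trans (ler_norm _)); exists N.
Qed.

(** * Joining two points by a continuum of controlled diameter *)

Section bounded_joining.
Context {R : realType} {d : nat}.
Implicit Types (K : set 'rV[R]_d) (c : R) (x y : 'rV[R]_d).

Definition joined K c x y := exists F,
  [/\ F `<=` K, continuum F, F x, F y &
      forall a b, F a -> F b -> l2dist a b <= c * l2dist x y].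

Lemma joined_bounded_turning K c :
  (forall x y, K x -> K y -> joined K c x y) -> bounded_turning c K.
Proof.
move=> Kc x y Kx Ky; have [F [FK cF Fx Fy Fxy]] := Kc x y Kx Ky.
exists F; split=> //; apply: ge_ereal_sup => _ [[a b] [/= Fa Fb] <-].
by rewrite lee_fin Fxy.
Qed.

Lemma joined_mono K c c' x y : c <= c' -> joined K c x y -> joined K c' x y.
Proof.
move=> cc' [F [FK cF Fx Fy Fxy]]; exists F; split=> // a b Fa Fb.
by rewrite (le_trans (Fxy a b Fa Fb))// ler_wpM2r ?l2dist_ge0.
Qed.

Lemma joined_refl K c x : 0 <= c -> K x -> joined K c x x.
Proof.
move=> c0 Kx; exists [set x]; split=> //; first by move=> _ ->.
  by split; [exact: compact_set1|exact: connected1].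
by move=> _ _ -> ->; rewrite l2distxx mulr0.
Qed.

Lemma joined_similarity (f : 'rV[R]_d -> 'rV[R]_d) K c x y :
  contracting_similarity f -> f @` K `<=` K ->
  joined K c x y -> joined K c (f x) (f y).
Proof.
move=> sf fK [F [FK [cF cnF] Fx Fy Fxy]]; exists (f @` F).
have cf : {within F, continuous f}.
  exact/continuous_subspaceT/similarity_continuous.
split; [|split|by exists x|by exists y|].
- by apply: subset_trans fK; exact: image_subset.
- exact: continuous_compact.
- exact: connected_continuous_connected.
move=> _ _ [a Fa <-] [b Fb <-]; have [r /andP[r0 _] fE] := sf.
by rewrite !fE mulrCA ler_pM2l// Fxy.
Qed.

(** By compactness the distances are bounded below, so all of K joins the points
    with a relative diameter that is bounded. *)
Lemma separated_joined K X Y : continuum K -> compact X -> compact Y ->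
  X `<=` K -> Y `<=` K -> X `&` Y = set0 ->
  exists c, forall x y, X x -> Y y -> joined K c x y.
Proof.
move=> [cK cnK] cX cY XK YK XY0.
have [D KD] := compact_l2dist_bounded cK.
have [e e0 eXY] := compact_separated cX cY XY0.
exists (D / e) => x y Xx Yy; exists K; split=> //; [exact: XK|exact: YK|].
move=> a b Ka Kb; have D0 : 0 <= D by rewrite -(l2distxx a) KD.
rewrite (le_trans (KD a b Ka Kb))// mulrAC ler_pdivlMr// ler_wpM2l//.
exact: le_trans (eXY x y Xx Yy) (norm_le_l2dist x y).
Qed.

(** The continua joining v to x and v to y are glued at v. *)
Lemma joined_through K c c' v x y : 0 <= c ->
  l2dist v x <= c' * l2dist x y -> l2dist v y <= c' * l2dist x y ->
  joined K c v x -> joined K c v y ->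
  joined K (d%:R * (c * c' + c * c') + c * c') x y.
Proof.
move=> c0 vx vy [F [FK [cF cnF] Fv Fx Fvx]] [G [GK [cG cnG] Gv Gy Gvy]].
have xy0 := l2dist_ge0 x y.
have Fxy a b : F a -> F b -> l2dist a b <= c * c' * l2dist x y.
  by move=> Fa Fb; rewrite (le_trans (Fvx a b Fa Fb))// -mulrA ler_wpM2l.
have Gxy a b : G a -> G b -> l2dist a b <= c * c' * l2dist x y.
  by move=> Ga Gb; rewrite (le_trans (Gvy a b Ga Gb))// -mulrA ler_wpM2l.
have cc0 : 0 <= c * c' * l2dist x y by rewrite -(l2distxx v) Fxy.
have FGxy a b : F a -> G b ->
    l2dist a b <= (d%:R * (c * c' + c * c')) * l2dist x y.
  move=> Fa Gb; rewrite (le_trans (l2dist_quasi_triangle a v b))//.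
  rewrite -[leRHS]mulrA ler_wpM2l ?ler0n// mulrDl.
  by apply: lerD; [exact: Fxy|exact: Gxy].
have dcc0 : 0 <= (d%:R * (c * c' + c * c')) * l2dist x y.
  by rewrite -mulrA mulr_ge0 ?ler0n// mulrDl addr_ge0.
exists (F `|` G); split.
- by move=> z [/FK|/GK].
- split; first exact: compactU.
  by apply: connectedU => //; exists v; split.
- by left.
- by right.
move=> a b [Fa|Ga] [Fb|Gb]; rewrite mulrDl.
- by rewrite (le_trans (Fxy a b Fa Fb))// lerDr.
- by rewrite (le_trans (FGxy a b Fa Gb))// lerDl.
- by rewrite l2distC (le_trans (FGxy b a Fb Ga))// lerDl.
- by rewrite (le_trans (Gxy a b Ga Gb))// lerDr.
Qed.

End bounded_joining.

(** * Iterated function systems of similarities *)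

Section iterated_function_system.
Context {R : realType} {d m : nat} (S : 'I_m -> 'rV[R]_d -> 'rV[R]_d).
Context (sS : forall k, contracting_similarity (S k)).
Implicit Types (K X Y : set 'rV[R]_d).

Lemma common_contraction_ratio : exists2 r, 0 <= r < 1 &
  forall k x y, l2dist (S k x) (S k y) <= r * l2dist x y.
Proof.
have /choice[r rS] k : exists r, 0 < r < 1 /\
    forall x y, l2dist (S k x) (S k y) = r * l2dist x y.
  by have [r r01 rE] := sS k; exists r.
exists (\big[Num.max/0]_k r k) => [|k x y].
  apply/andP; split; first by apply/bigmax_geP; left.
  by apply/bigmax_ltP; split=> // k _; have [/andP[]] := rS k.
by rewrite (rS k).2 ler_wpM2r ?l2dist_ge0//; apply: le_bigmax.
Qed.

(** If r < 1 bounds all ratios, a point of X lies within M r^N of a point of Y: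
    pull it back N times into X, compare with y0 there, and push forward. This
    places the attractor in the polygon, and the vertices in the attractor. *)
Lemma ifs_sub_closed X Y M y0 :
  X `<=` \bigcup_k (S k @` X) -> (forall x, X x -> l2dist x y0 <= M) ->
  closed Y -> Y y0 -> (forall k, S k @` Y `<=` Y) -> X `<=` Y.
Proof.
move=> XS XM clY Yy0 SY x Xx; have [r r01 rS] := common_contraction_ratio.
have r0 : 0 <= r by case/andP: r01.
have approx N z : X z -> exists2 y, Y y & l2dist z y <= M * r ^+ N.
  elim: N z => [|N IH] z Xz; first by exists y0; rewrite ?expr0 ?mulr1 ?XM.
  have [k _ [z' Xz' <-]] := XS _ Xz; have [y Yy z'y] := IH _ Xz'.
  exists (S k y); first by apply: (SY k); exists y.
  by rewrite (le_trans (rS k _ _))// exprS mulrCA ler_wpM2l.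
rewrite (closure_id Y).1// => V /nbhs_ballP[e /= e0 eV].
have [N Ne] := geometric_small M r01 e0; have [y Yy xy] := approx N x Xx.
exists y; split=> //; apply: eV; rewrite -ball_normE/=.
by rewrite (le_lt_trans (norm_le_l2dist _ _))// (le_lt_trans xy).
Qed.

(** As long as a pair in E can be pulled back to another pair in E, its distance
    grows at least by the factor 1 / r, where r bounds all ratios; since K is bounded, a pair of distinct points
    reaches after finitely many steps a pair that is already joined. *)
Lemma joined_descent K c (E : 'rV[R]_d -> 'rV[R]_d -> Prop) : 0 <= c ->
  compact K -> (forall k, S k @` K `<=` K) ->
  (forall x y, E x y -> K x /\ K y) ->
  (forall x y, E x y -> joined K c x y \/
     exists k x' y', [/\ x = S k x', y = S k y' & E x' y']) ->
  forall x y, E x y -> joined K c x y.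
Proof.
move=> c0 cK SK EK Edesc x y Exy; have [r r01 rS] := common_contraction_ratio.
have r0 : 0 <= r by case/andP: r01.
have [D KD] := compact_l2dist_bounded cK.
have joinedN N u v : E u v -> D * r ^+ N < l2dist u v -> joined K c u v.
  elim: N u v => [|N IH] u v Euv.
    by rewrite expr0 mulr1 ltNge KD; have [] := EK _ _ Euv.
  move=> Duv; have [//|[k [u' [v' [uE vE Euv']]]]] := Edesc _ _ Euv.
  rewrite uE vE; apply: joined_similarity => //; apply: IH => //.
  move: Duv; rewrite uE vE exprS mulrCA => /lt_le_trans/(_ (rS k _ _)).
  have [rz|rN0] := eqVneq r 0; first by rewrite rz !mul0r ltxx.
  by rewrite ltr_pM2l// lt_neqAle eq_sym rN0.
have [<-|xyN] := eqVneq x y; first by apply: joined_refl => //; have [] := EK _ _ Exy.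
have xy0 : 0 < l2dist x y.
  by rewrite lt_neqAle l2dist_ge0 andbT; apply: contraNneq xyN => /esym/l2dist0_eq ->.
have [N DN] := geometric_small D r01 xy0; exact: joinedN Exy DN.
Qed.

(** A clopen part B of K is at positive distance from the rest of K, hence it is
    saturated: it contains all points of K within M r^N of its points, for
    some N, where M bounds the diameter of K and r bounds the ratios. By induction on N such a part is empty or all of K. In the
    inductive step, the preimages of B are saturated at the previous level, so
    each piece is inside or outside B; this splits the P_k into two families
    with disjoint closed unions. *)
Lemma attractor_connected K (P : 'I_m -> set 'rV[R]_d) :
  compact K -> K = \bigcup_k (S k @` K) ->
  (forall k, closed (P k)) -> (forall k, S k @` K `<=` P k) ->
  (forall i j, i != j -> P i `&` P j !=set0 ->
     (S i @` K) `&` (S j @` K) !=set0) ->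
  connected (\bigcup_k P k) -> connected K.
Proof.
move=> cK KS clP SKP PK cnP.
have [r r01 rS] := common_contraction_ratio.
have r0 : 0 <= r by case/andP: r01.
have [M KM] := compact_l2dist_bounded cK.
have SK k x : K x -> K (S k x) by move=> Kx; rewrite KS; exists k => //; exists x.
have saturated N (B : set 'rV[R]_d) :
    (forall x y, K x -> K y -> B x -> l2dist x y <= M * r ^+ N -> B y) ->
    forall x y, K x -> K y -> B x -> B y.
  elim: N B => [|N IH] B satB x y Kx Ky Bx.
    by apply: (satB x y) => //; rewrite expr0 mulr1 KM.
  have SB k a b : K a -> K b -> B (S k a) -> B (S k b).
    apply: (IH (S k @^-1` B)) => u v Ku Kv Bu uv.
    apply: (satB (S k u)) => //; try exact: SK.
    by rewrite (le_trans (rS k _ _))// exprS mulrCA ler_wpM2l.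
  (* By SB, a piece that meets B lies inside B. *)
  pose J := [set k | exists2 a, K a & B (S k a)].
  pose V := \bigcup_(k in J) P k; pose W := \bigcup_(k in ~` J) P k.
  have finI (I : set 'I_m) : finite_set I by exact: finite_finset.
  have VW z : V z -> W z -> False.
    move=> [i Ji Pz] [j Jj Pjz]; have ij : i != j.
      by apply/eqP => ijE; apply: Jj; rewrite -ijE.
    have [|w [[a Ka aw] [b Kb bw]]] := PK i j ij; first by exists z.
    have [a' Ka' Ba'] := Ji; apply: Jj; exists b => //.
    by rewrite bw -aw; apply: (SB i a').
  have UV : V = \bigcup_k P k.
    apply: cnP.
    - move: Kx; rewrite [in X in X -> _]KS => -[k _ [a Ka ax]].
      exists x, k; last by apply: SKP; exists a.
      by exists a => //; rewrite ax.
    - exists (~` W); first by apply: closed_openC; apply: closed_bigcup.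
      apply/seteqP; split=> z.
        by move=> Vz; split; [case: Vz => k _ Pz; exists k|move=> /(VW z Vz)].
      move=> [[k _ Pz] Wz]; exists k => //; apply: contrapT => Jk.
      by apply: Wz; exists k.
    - exists V; first exact: closed_bigcup.
      by apply/seteqP; split=> [z Vz|z []//]; split=> //; case: Vz => k _ Pz; exists k.
  move: (Ky); rewrite [in X in X -> _]KS => -[j _ [b Kb bz]].
  have Vy : V y by rewrite UV; exists j => //; apply: SKP; exists b.
  have [a Ka Ba] : J j.
    apply: contrapT => Jj; apply: (VW y Vy); exists j => //.
    by apply: SKP; exists b.
  by rewrite -bz; apply: (SB j a).
move=> B [x Bx] [U oU BU] [C cC BC].
have BK : B `<=` K by rewrite BC; exact: subIsetl.
have cB : compact B by rewrite BC; apply: compact_closedI.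
have cKB : compact (K `&` ~` U) by apply: compact_closedI => //; exact: open_closedC.
have [e e0 eB] : exists2 e, 0 < e &
    forall x y, B x -> (K `&` ~` U) y -> e <= `|x - y|.
  apply: compact_separated => //; apply/seteqP; split=> // z [Bz [_ Uz]].
  by apply: Uz; move: Bz; rewrite BU => -[].
have [N Ne] := geometric_small M r01 e0.
apply/seteqP; split=> // y Ky; apply: (saturated N B _ x) => //; last exact: BK.
move=> u v Ku Kv Bu uv; apply: contrapT => Bv.
have /(eB u v Bu) : (K `&` ~` U) v by split=> // Uv; apply: Bv; rewrite BU.
by apply/negP; rewrite -ltNge (le_lt_trans (norm_le_l2dist _ _))// (le_lt_trans uv).
Qed.

End iterated_function_system.

(** * Polytopes and their vertices *)

Section polytope.
Context {R : realType} {d n : nat} (A : 'I_n -> 'rV[R]_d).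

Definition other_vertices_hull p := conv_hull (A @` [set j | j != p]).

Lemma range_vertex p : range A = A p |` A @` [set j | j != p].
Proof.
apply/seteqP; split=> [_ [j _ <-]|_ [->|[j _ <-]]]; [|by exists p|by exists j].
by have [->|jp] := eqVneq j p; [left|right; exists j].
Qed.

Lemma polytope_pyramid p :
  conv_hull (range A) = pyramid (A p) (other_vertices_hull p).
Proof. by rewrite (range_vertex p) conv_hull_pyramid. Qed.

Lemma other_vertices_hull_compact p : compact (other_vertices_hull p).
Proof. apply: finite_conv_hull_compact; apply: finite_image; exact: finite_finset. Qed.

(** Otherwise f would map all vertices into the polytope punctured at A p, which
    is convex; as f is affine it would map the whole polytope there. *)
Lemma vertex_preimage (f : 'rV[R]_d -> 'rV[R]_d) p : contracting_similarity f ->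
  f @` conv_hull (range A) `<=` conv_hull (range A) ->
  ~ other_vertices_hull p (A p) -> (f @` conv_hull (range A)) (A p) ->
  exists q, A p = f (A q).
Proof.
move=> sf fP Hp [z Pz zp]; apply: contrapT => noq.
have extreme := @conv_hull_vertex_extreme _ _ _ _ Hp.
rewrite -range_vertex in extreme.
suff [_] : (conv_hull (range A) `\ A p) (f z) by apply.
apply: (conv_hull_min (C := f @^-1` (conv_hull (range A) `\ A p))) Pz => /=.
  move=> x y t t01 Cx Cy; rewrite similarity_affine//; exact: extreme.
move=> _ [q _ <-]; split; last by move=> fq; apply: noq; exists q.
by apply: fP; exists (A q) => //; apply: sub_conv_hull; exists q.
Qed.

End polytope.

(** * Polygonal tree systems *)

(** Every point is linked to the base point by its track under the homotopy. *)
Lemma contractible_connected {R : realType} {T : topologicalType} (A : set T) :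
  contractible R A -> connected A.
Proof.
move=> [x0 [Ax0 [H [cH HA H0 H1]]]].
have -> : A = \bigcup_(x in A) ((fun t : R => H (x, t)) @` `[0, 1]).
  apply/seteqP; split=> [x Ax|_ [x Ax [t t01 <-]]]; last exact: HA.
  by exists x => //; exists 0; [rewrite /= in_itv/= lexx ler01|rewrite H0].
apply: bigcup_connected.
  by exists x0 => x Ax; exists 1; [rewrite /= in_itv/= lexx ler01|rewrite H1].
move=> x Ax; apply: connected_continuous_connected; first exact: segment_connected.
apply/subspace_continuousP => t t01.
have /subspace_continuousP/(_ (x, t)) := cH.
move=> /(_ (conj Ax t01)) cHxt.
apply: cvg_trans cHxt => V /=.
rewrite /nbhs/= /within/= => -[[U1 U2] /= [nU1 nU2] UV].
have U1x := nbhs_singleton nU1.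
by apply: filterS nU2 => s U2s s01; apply: (UV (x, s)).
Qed.

Section polygonal_tree_system.
Context {R : realType} {n m : nat} {A : 'I_n -> 'rV[R]_2}
  {P K : set 'rV[R]_2} {S : 'I_m -> 'rV[R]_2 -> 'rV[R]_2}.
Context (hP : convex_polygon A P) (hS : polygonal_tree_system A P S)
  (hK : attractor S K).

Let sS k : contracting_similarity (S k). Proof. exact: (pts_similarity hS). Qed.

Let PE : P = conv_hull (range A). Proof. by case: hP. Qed.

Let PA l : P (A l).
Proof. by rewrite PE; apply: sub_conv_hull; exists l. Qed.

Let vertexN p : ~ other_vertices_hull A p (A p).
Proof. by case: hP => _ + _; apply. Qed.

Let cK : compact K. Proof. by case: hK. Qed.

Let KS : K = \bigcup_k (S k @` K). Proof. by case: hK. Qed.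

Let SK k : S k @` K `<=` K.
Proof. by rewrite [in X in _ `<=` X]KS => z Kz; exists k. Qed.

Lemma polygon_compact : compact P.
Proof.
rewrite PE; apply: finite_conv_hull_compact; apply: finite_image.
exact: finite_finset.
Qed.

Lemma similarity_image_compact k X : compact X -> compact (S k @` X).
Proof.
move=> cX; apply: continuous_compact => //.
exact/continuous_subspaceT/similarity_continuous.
Qed.

Lemma attractor_sub_polygon : K `<=` P.
Proof.
have [_ _ [p0 /interior_subset Pp0]] := hP.
have /compact_l2dist_bounded[M KM] : compact (K `|` [set p0]).
  by apply: compactU => //; exact: compact_set1.
apply: (ifs_sub_closed sS (M := M) (y0 := p0)) => //.
- by rewrite [in X in X `<=` _]KS.
- by move=> x Kx; apply: KM; [left|right].
- exact: compact_closed (@norm_hausdorff _ _) polygon_compact.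
- exact: (pts_sub hS).
Qed.

Lemma vertex_in_piece p i : (S i @` P) (A p) -> exists q, A p = S i (A q).
Proof.
rewrite PE; apply: vertex_preimage => //.
by rewrite -PE; exact: (pts_sub hS).
Qed.

Lemma vertex_in_attractor p : K (A p).
Proof.
have [[y0 Ky0] _ _] := hK.
have /compact_l2dist_bounded[M KM] : compact (P `|` [set y0]).
  by apply: compactU; [exact: polygon_compact|exact: compact_set1].
apply: (ifs_sub_closed sS (X := range A) (M := M) (y0 := y0)) => //.
- move=> _ [l _ <-]; have [i /vertex_in_piece[q lE]] := pts_vertex hS l.
  by rewrite lE; exists i => //; exists (A q) => //; exists q.
- by move=> _ [l _ <-]; apply: KM; [left; exact: PA|right].
- exact: compact_closed (@norm_hausdorff _ _) cK.
Qed.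

Lemma attractor_continuum : continuum K.
Proof.
split => //; apply: (attractor_connected sS (P := fun k => S k @` P)) => //.
- move=> k; apply: compact_closed; first exact: norm_hausdorff.
  exact/similarity_image_compact/polygon_compact.
- by move=> k; apply: image_subset; exact: attractor_sub_polygon.
- move=> i j ij [z Pz]; have [ij0|[x [_ [p _ px] [q _ qx]]]] := pts_inter hS ij.
    by move: Pz; rewrite ij0.
  exists x; split; [exists (A p)|exists (A q)] => //; exact: vertex_in_attractor.
- exact: contractible_connected (pts_contractible hS).
Qed.

(** If the vertex and the point lie in a common piece, both are pulled back, the
    vertex to a vertex; otherwise they are at distance bounded below. *)
Lemma vertex_joined : exists2 c, 1 <= c & forall p x, K x -> joined K c (A p) x.
Proof.
have [||c c1 cP] := @finite_uniform_bound R _ (fun (pi : 'I_n * 'I_m) c =>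
    ~ (S pi.2 @` P) (A pi.1) -> forall y, (S pi.2 @` K) y ->
    joined K c (A pi.1) y).
- by move=> [p i] c c' cc' /= H piN y Ky; exact: joined_mono cc' (H piN y Ky).
- move=> [p i] /=; have [pi|piN] := pselect ((S i @` P) (A p)); first by exists 0.
  have [|||c cP] := separated_joined attractor_continuum
      (@compact_set1 _ (A p)) (similarity_image_compact (k := i) cK).
  + by move=> _ ->; exact: vertex_in_attractor.
  + exact: SK.
  + apply/seteqP; split=> // _ [-> Kp]; apply: piN.
    by move: Kp; apply: image_subset; exact: attractor_sub_polygon.
  by exists c => _ y Ky; apply: cP.
exists c => // p x Kx; have c0 : 0 <= c by rewrite (le_trans ler01).
apply: (joined_descent sS (E := fun y x => range A y /\ K x)) => //.
- by move=> _ y [[l _ <-] Ky]; split => //; exact: vertex_in_attractor.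
- move=> _ y [[l _ <-] Ky]; move: (Ky); rewrite [in X in X -> _]KS.
  move=> [i _ [y' Ky' yE]].
  have [/vertex_in_piece[q lE]|/(cP (l, i)) /= far] := pselect ((S i @` P) (A l)).
    by right; exists i, (A q), y'; split => //; split => //; exists q.
  by left; apply: far; exists y'.
Qed.

(** At the common vertex the two pieces are pyramids with that apex, and they
    meet nowhere else. *)
Lemma pieces_angle i j p q : i != j -> S i (A p) = S j (A q) ->
  exists c, forall a b, K a -> K b ->
    l2dist (S i (A p)) (S i a) <= c * l2dist (S i a) (S j b).
Proof.
move=> ij pq.
have [ij0|[v [vE _ _]]] := pts_inter hS ij.
  exfalso; rewrite -[False]/(set0 (S i (A p))) -ij0.
  by split; [exists (A p)|rewrite pq; exists (A q)].
have vp : S i (A p) = v.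
  suff : [set v] (S i (A p)) by [].
  by rewrite -vE; split; [exists (A p)|rewrite pq; exists (A q)].
have piece k l : S k @` P = pyramid (S k (A l)) (S k @` other_vertices_hull A l).
  by rewrite PE (polytope_pyramid A l) similarity_pyramid.
have cH k l : compact (S k @` other_vertices_hull A l).
  exact/similarity_image_compact/other_vertices_hull_compact.
have HN k l : ~ (S k @` other_vertices_hull A l) (S k (A l)).
  by move=> [u Hu /(similarity_inj (sS k)) ul]; apply: (@vertexN l); rewrite -ul.
have [||c cP] := pyramid_angle (cH i p) (cH j q) (HN i p).
- by rewrite pq; exact: HN.
- by rewrite -piece [X in pyramid X]pq -piece vE vp.
exists (2%:R * `|c|) => a b Ka Kb.
rewrite (le_trans (l2dist_le_norm _ _))// -mulrA ler_wpM2l// distrC.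
have Pa : pyramid (S i (A p)) (S i @` other_vertices_hull A p) (S i a).
  by rewrite -piece; exists a => //; exact: attractor_sub_polygon.
have Pb : pyramid (S i (A p)) (S j @` other_vertices_hull A q) (S j b).
  by rewrite pq -piece; exists b => //; exact: attractor_sub_polygon.
rewrite (le_trans (cP _ _ Pa Pb))//; apply: (@le_trans _ _ (`|c| * `|S i a - S j b|)).
  by rewrite ler_wpM2r// ler_norm.
by rewrite ler_wpM2l// norm_le_l2dist.
Qed.

(** Disjoint pieces are separated; otherwise the joining continuum passes through
    the common vertex v, and the positive angle at v bounds its diameter. *)
Lemma distinct_pieces_joined i j : i != j -> exists c, forall a b, K a -> K b ->
  joined K c (S i a) (S j b).
Proof.
move=> ij; have [ij0|[v [_ [p _ /= pv] [q _ /= qv]]]] := pts_inter hS ij.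
  have [|||c cP] := separated_joined attractor_continuum
      (similarity_image_compact (k := i) cK) (similarity_image_compact (k := j) cK).
  - exact: SK.
  - exact: SK.
  - apply/seteqP; split=> // z [Kiz Kjz]; rewrite -ij0.
    by split; [move: Kiz|move: Kjz]; apply: image_subset;
      exact: attractor_sub_polygon.
  by exists c => a b Ka Kb; apply: cP; [exists a|exists b].
have [c c1 cP] := vertex_joined.
have pq : S i (A p) = S j (A q) by rewrite pv.
have [c2 c2P] := pieces_angle ij pq.
have [|c3 c3P] := @pieces_angle j i q p _ (esym pq); first by rewrite eq_sym.
(* The distances from v to the two points are at most c' times their mutual
   distance, and the continua joining v to them are glued. *)
pose c' := `|c2| + `|c3|.
exists (2%:R * (c * c' + c * c') + c * c') => a b Ka Kb.
have xy0 := l2dist_ge0 (S i a) (S j b).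
apply: (joined_through (v := v)).
- exact: le_trans c1.
- rewrite -pv (le_trans (c2P _ _ Ka Kb))// ler_wpM2r//.
  by rewrite (le_trans (ler_norm _))// lerDl.
- rewrite -qv (le_trans (c3P _ _ Kb Ka))// l2distC ler_wpM2r//.
  by rewrite (le_trans (ler_norm _))// lerDr.
- by rewrite -pv; apply: joined_similarity => //; exact: cP.
- by rewrite -qv; apply: joined_similarity => //; exact: cP.
Qed.

End polygonal_tree_system.

Unset Implicit Arguments.

Theorem theorem25 (R : realType) (n m : nat) (A : 'I_n -> 'rV[R]_2)
    (P : set 'rV[R]_2) (S : 'I_m -> 'rV[R]_2 -> 'rV[R]_2) (K : set 'rV[R]_2)
    (hP : convex_polygon A P) (hS : polygonal_tree_system A P S)
    (hK : attractor S K) :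
  continuum K /\ exists2 c : R, 1 <= c & bounded_turning c K.
Proof.
split; first exact: (attractor_continuum hP hS hK).
have [_ cK KS] := hK.
have [||c c1 cP] := @finite_uniform_bound R _ (fun (ij : 'I_m * 'I_m) c =>
    ij.1 != ij.2 -> forall a b, K a -> K b -> joined K c (S ij.1 a) (S ij.2 b)).
- move=> [i j] c c' cc' /= H ij a b Ka Kb.
  exact: joined_mono cc' (H ij a b Ka Kb).
- move=> [i j] /=; have [->|ij] := eqVneq i j; first by exists 0.
  by have [c cP] := distinct_pieces_joined hP hS hK ij; exists c => _.
exists c => //; apply: joined_bounded_turning => x y Kx Ky.
apply: (joined_descent (pts_similarity hS) (E := fun x y => K x /\ K y)) => //.
- exact: le_trans c1.
- by move=> k; rewrite [in X in _ `<=` X]KS => z Kz; exists k.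
move=> {}x {}y [{}Kx {}Ky].
move: (Kx); rewrite [in X in X -> _]KS => -[i _ [a Ka <-]].
move: (Ky); rewrite [in X in X -> _]KS => -[j _ [b Kb <-]].
have [<-|ij] := eqVneq i j; first by right; exists i, a, b.
by left; apply: (cP (i, j)).
Qed.
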